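(* For every fixed integer $\ell\ge 2$, the Efficient Domination problem can be solved in polynomial time on $\ell P_4$-free bipartite graphs.
   Context: For a graph $G=(V,E)$ and $v\in V$, $N[v]$ is the closed neighborhood of $v$. A set $D\subseteq V$ is an efficient dominating set (e.d.s.) of $G$ if $|N[v]\cap D|=1$ for every $v\in V$. The Efficient Domination (ED) problem asks whether a given graph has an e.d.s. $P_4$ is the chordless path on 4 vertices, and $\ell P_4$ is the disjoint union of $\ell$ copies of $P_4$ (no edges between copies). A graph is $H$-free if it has no induced subgraph isomorphic to $H$. *)

(* Defs.v *)
From mathcomp Require Import all_boot ssralg poly.

Set Implicit Arguments.
Unset Strict Implicit.
Unset Printing Implicit Defensive.

Record sgraph (T : finType) := SGraph {
  adj :> rel T;
  adj_sym : symmetric adj;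
  adj_irrefl : irreflexive adj }.

Definition closed_nbhd (T : finType) (G : sgraph T) (v : T) : {set T} :=
  [set u | (u == v) || G v u].

Definition efficient_dominating (T : finType) (G : sgraph T) (D : {set T}) :
  Prop := forall v : T, #|closed_nbhd G v :&: D| = 1.

Definition has_eds (T : finType) (G : sgraph T) : Prop :=
  exists D : {set T}, efficient_dominating G D.

Definition bipartite (T : finType) (G : sgraph T) : Prop :=
  exists c : T -> bool, forall x y : T, G x y -> c x != c y.

Definition induced_copy (S T : finType) (H : sgraph S) (G : sgraph T) : Prop :=
  exists f : S -> T, injective f /\ forall x y : S, G (f x) (f y) = H x y.

Definition induced_free (S T : finType) (H : sgraph S) (G : sgraph T) : Prop :=
  ~ induced_copy H G.

Definition path_rel (n : nat) : rel 'I_n :=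
  fun i j => (i.+1 == j :> nat) || (j.+1 == i :> nat).

Lemma path_rel_sym n : symmetric (@path_rel n).
Proof. by move=> i j; rewrite /path_rel orbC. Qed.

Lemma path_rel_irrefl n : irreflexive (@path_rel n).
Proof. by move=> i; rewrite /path_rel orbb eqn_leq ltnn. Qed.

Definition path_graph (n : nat) : sgraph 'I_n :=
  SGraph (@path_rel_sym n) (@path_rel_irrefl n).

Section Copies.
Variables (l : nat) (T : finType) (H : sgraph T).

Definition copies_rel : rel ('I_l * T) :=
  fun x y => (x.1 == y.1) && H x.2 y.2.

Lemma copies_rel_sym : symmetric copies_rel.
Proof. by move=> x y; rewrite /copies_rel eq_sym adj_sym. Qed.

Lemma copies_rel_irrefl : irreflexive copies_rel.
Proof. by move=> x; rewrite /copies_rel adj_irrefl andbF. Qed.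

Definition copies : sgraph ('I_l * T)%type :=
  SGraph copies_rel_sym copies_rel_irrefl.
End Copies.

(* Random access machine with unit costs. Addition and truncated subtraction are
   the only arithmetic operations, so a step lengthens the largest value by at
   most one bit (up to constants of the program), and polynomial time on this
   machine agrees with polynomial time on Turing machines; multiplication at
   unit cost would break this. The first argument of an arithmetic instruction
   or of Read is the destination register; Read and Write address the memory
   indirectly, through the content of a register. *)
Inductive instr :=
  | Const (d c : nat)
  | Add (d a b : nat)
  | Sub (d a b : nat)
  | Read (d a : nat)
  | Write (a s : nat)
  | Jump (k : nat)
  | Jzero (a k : nat).

Definition program := seq instr.

Record config := Config { pc : nat; reg : nat -> nat; mem : nat -> nat }.

Definition upd (f : nat -> nat) (k v : nat) : nat -> nat :=
  fun x => if x == k then v else f x.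

Definition exec (i : instr) (s : config) : config :=
  let: Config p R M := s in
  match i with
  | Const d c => Config p.+1 (upd R d c) M
  | Add d a b => Config p.+1 (upd R d (R a + R b)) M
  | Sub d a b => Config p.+1 (upd R d (R a - R b)) M
  | Read d a => Config p.+1 (upd R d (M (R a))) M
  | Write a v => Config p.+1 R (upd M (R a) (R v))
  | Jump k => Config k R M
  | Jzero a k => Config (if R a == 0 then k else p.+1) R M
  end.

(* The machine halts when the program counter leaves the program. *)
Definition halted (P : program) (s : config) : bool := size P <= pc s.

Definition step (P : program) (s : config) : config :=
  if onth P (pc s) is Some i then exec i s else s.

(* Input: register 0 holds the number n of vertices, and the first n ^ 2 memory
   cells hold the adjacency matrix, row by row; everything else is 0. *)
Definition init (n : nat) (G : sgraph 'I_n) : config :=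
  Config 0 (upd (fun _ => 0) 0 n)
    (nth 0 [seq nat_of_bool (G i j) | i <- enum 'I_n, j <- enum 'I_n]).

(* Q is decided in polynomial time on the class C: nothing is required of the
   program on inputs outside C. Register 0 holds the answer, nonzero for yes. *)
Definition poly_time_on (C Q : forall n : nat, sgraph 'I_n -> Prop) : Prop :=
  exists (P : program) (p : {poly nat}),
    forall (n : nat) (G : sgraph 'I_n), C n G ->
      exists t : nat, let s := iter t (step P) (init G) in
        [/\ t <= p.[n]%R, halted P s & reg s 0 != 0 <-> Q n G].

(* Main.v *)
Require Import Defs.
From mathcomp Require Import all_boot ssralg poly zify.

(* On bipartite [l P4]-free graphs with a linear order on the vertices, having an
   efficient dominating set is first-order definable, and a first-order sentence
   is evaluated in polynomial time by nested loops.

   Let [D] be an efficient dominating set, and [Q] the vertex set of a maximal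
   induced family of [P4]s, so that [G - N[Q]] is [P4]-free. If the seed [W]
   included in [D] contains the dominators of [Q], then the vertices whose
   membership in [D] is not settled by [W] lie outside [N[Q]], and two rounds of
   local elimination leave only adjacent pairs [{z, z2}] with exactly one vertex
   in [D]. Such a pair matters only to a further neighbour [a] of, say, [z], with
   dominator [d]. If [z] is not in [D], then [z2 - z - a - d] is a [P4]; a minimal
   set of [d]'s whose second neighbourhoods contain all these [z] on one side of
   the bipartition yields that many independent [P4]s, hence has fewer than [l]
   elements. With such sets added to [W] (at most [6 l] vertices in total), all
   pairs are settled but those forming isolated edges of the remaining problem,
   where the order makes the choice. *)

Set Implicit Arguments.
Unset Strict Implicit.
Unset Printing Implicit Defensive.

(** * Propagation from a seed *)

Section Graph.
Variables (T : finType) (G : sgraph T).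
Implicit Types (u v w x y z d : T) (D W Q : {set T}).

Definition nb x y := (x == y) || G x y.

Lemma nb_sym x y : nb x y = nb y x.
Proof. by rewrite /nb eq_sym adj_sym. Qed.

Lemma nbxx x : nb x x.
Proof. by rewrite /nb eqxx. Qed.

Lemma adj_nb x y : G x y -> nb x y.
Proof. by rewrite /nb => ->; rewrite orbT. Qed.

Lemma in_closed_nbhd v u : (u \in closed_nbhd G v) = nb v u.
Proof. by rewrite inE /nb eq_sym. Qed.

Lemma efficient_dominatingP D : efficient_dominating G D <->
  (forall v, exists2 d, d \in D & nb v d) /\
  (forall v d d', d \in D -> d' \in D -> nb v d -> nb v d' -> d = d').
Proof.
split=> [hD | [ex un] v].
  split=> [v | v d d' dD d'D vd vd'].
    have /cards1P[d Ed] : #|closed_nbhd G v :&: D| == 1 by rewrite hD.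
    have : d \in closed_nbhd G v :&: D by rewrite Ed set11.
    by rewrite inE in_closed_nbhd => /andP[vd dD]; exists d.
  have /cards1P[e Ee] : #|closed_nbhd G v :&: D| == 1 by rewrite hD.
  have : d \in [set e] by rewrite -Ee inE in_closed_nbhd vd.
  have : d' \in [set e] by rewrite -Ee inE in_closed_nbhd vd'.
  by rewrite !inE => /eqP-> /eqP->.
have [d dD vd] := ex v; apply/eqP/cards1P; exists d; apply/setP=> x.
rewrite in_setI in_closed_nbhd in_set1; apply/andP/eqP=> [[vx xD] | ->] //.
exact: un vx vd.
Qed.

(* [W] is the guessed part of the efficient dominating set. A vertex is a
   candidate if adding it to [W] dominates nothing twice, and good if in addition
   every vertex left undominated keeps a candidate. *)
Definition dom W v := [exists w, (w \in W) && nb v w].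
Definition cand W u := ~~ [exists v, nb u v && dom W v].
(** Disjoint closed neighbourhoods, that is, distance at least three, as between two members of an
    efficient dominating set. *)
Definition far x y := ~~ [exists v, nb x v && nb y v].
Definition good W u := cand W u &&
  ~~ [exists v, [&& ~~ dom W v, ~~ nb u v &
     ~~ [exists u', [&& nb v u', cand W u' & far u' u]]]].
Definition forced W u := good W u && [exists v, nb u v &&
  ~~ [exists u', [&& nb v u', good W u' & u' != u]]].
(** When two adjacent good vertices are both unforced, the order breaks the tie in favour of the
    lower one. *)
Definition final (lt : rel T) W u := (u \in W) || (good W u && (forced W u ||
  ~~ [exists u', [&& G u u', good W u' & forced W u' || ~~ lt u u']])).

Lemma candP W u : reflect (forall v w, w \in W -> nb u v -> ~~ nb v w) (cand W u).
Proof.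
apply: (iffP idP) => [/existsPn h v w wW uv | h].
  apply: contraNN (h v) => vw; rewrite uv; apply/existsP; exists w.
  by rewrite wW.
apply/existsPn=> v; apply/negP=> /andP[uv /existsP[w /andP[wW vw]]].
by move: (h v w wW uv); rewrite vw.
Qed.

Lemma farP x y : reflect (forall v, nb x v -> ~~ nb y v) (far x y).
Proof.
apply: (iffP existsPn) => h v; last by apply/negP=> /andP[/h/negbTE->].
by move=> xv; have := h v; rewrite xv.
Qed.

Lemma goodP W u : reflect (cand W u /\ forall v, ~~ dom W v -> ~~ nb u v ->
   exists u', [/\ nb v u', cand W u' & far u' u]) (good W u).
Proof.
apply: (iffP andP) => [] [cu h]; split=> //.
  move=> v nv uv; move/existsPn/(_ v): h; rewrite nv uv /= negbK.
  by move=> /existsP[u' /and3P[? ? ?]]; exists u'.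
apply/existsPn=> v; apply/negP=> /and3P[nv uv /negP[]]; apply/existsP.
by have [u' [? ? ?]] := h v nv uv; exists u'; apply/and3P.
Qed.

Lemma forcedP W u : reflect (good W u /\ exists2 v, nb u v &
  forall u', nb v u' -> good W u' -> u' = u) (forced W u).
Proof.
apply: (iffP andP) => [[gu /existsP[v /andP[uv /existsPn h]]] | [gu [v uv h]]].
  split=> //; exists v => // u' vu' gu'; apply/eqP; move: (h u').
  by rewrite vu' gu' /= negbK.
split=> //; apply/existsP; exists v; rewrite uv; apply/existsPn=> u'.
by apply/negP=> /and3P[vu' gu' /eqP[]]; apply: h.
Qed.

Definition outside Q u := forall q, q \in Q -> ~~ nb q u.

(* The undecided vertices [z] that a vertex [a] needing a dominator could see
   besides its actual dominator [d]; [z2] is the only alternative to [z]. *)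
Definition contested D Q z := [/\ z \notin D, outside Q z,
  exists z2, [/\ z2 \in D, G z z2 & forall y, outside Q y -> G z2 y -> y = z] &
  exists d a, [/\ d \in D, G d a & G a z]].

Section Propagation.
Variables (col : T -> bool) (D Q W : {set T}) (lt : rel T).
Hypothesis colP : forall x y, G x y -> col x != col y.
Hypothesis hD : efficient_dominating G D.
Hypothesis P4_freeQ : forall x1 x2 x3 x4, outside Q x1 -> outside Q x2 ->
  outside Q x3 -> outside Q x4 -> G x1 x2 -> G x2 x3 -> G x3 x4 -> G x1 x4.
Hypothesis sWD : W \subset D.
Hypothesis domQ : forall q, q \in Q -> dom W q.
Hypothesis contestedW : forall z, contested D Q z ->
  exists d a, [/\ d \in W, G d a & G a z].
Hypothesis ltP : forall x y, x != y -> lt x y = ~~ lt y x.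

Let Dex : forall v, exists2 d, d \in D & nb v d.
Proof. by case/efficient_dominatingP: hD. Qed.

Let Dun : forall v d d', d \in D -> d' \in D -> nb v d -> nb v d' -> d = d'.
Proof. by case/efficient_dominatingP: hD. Qed.

Let Dadj d d' : d \in D -> d' \in D -> G d d' = false.
Proof.
move=> dD d'D; apply/negP=> dd'.
have E := Dun dD d'D (nbxx d) (adj_nb dd').
by move: dd'; rewrite E adj_irrefl.
Qed.

Let WD w : w \in W -> w \in D. Proof. exact: (subsetP sWD). Qed.

Lemma cand_outside u : cand W u -> outside Q u.
Proof.
move=> /candP cu q qQ; have /existsP[w /andP[wW qw]] := domQ qQ.
by apply/negP=> qu; move: (cu q w wW); rewrite nb_sym qu qw => /(_ isT).
Qed.

Lemma cand_ndom u v : cand W u -> nb u v -> ~~ dom W v.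
Proof.
move=> /candP cu uv; apply/existsPn=> w; apply/negP=> /andP[wW vw].
by move: (cu v w wW uv); rewrite vw.
Qed.

Lemma good_cand u : good W u -> cand W u. Proof. by case/andP. Qed.

Lemma D_cand d : d \in D -> d \notin W -> cand W d.
Proof.
move=> dD dW; apply/candP=> v w wW dv; apply/negP=> vw; move: dW.
rewrite nb_sym in dv.
by rewrite (Dun dD (WD wW) dv vw) wW.
Qed.

Lemma ndom_notinW v d : ~~ dom W v -> nb v d -> d \notin W.
Proof.
by move=> /existsPn/(_ d) h vd; apply: contraNN h => ->; rewrite vd.
Qed.

(** The candidate kept for [v] is its dominator in [D], which is far from [d] because no vertex has
    two dominators. *)
Lemma D_good d : d \in D -> d \notin W -> good W d.
Proof.
move=> dD dW; apply/goodP; split; first exact: D_cand.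
move=> v nv dv; have [u uD vu] := Dex v; exists u; split=> //.
  by apply: D_cand => //; apply: ndom_notinW vu.
apply/farP=> x ux; apply/negP=> dx; case/negP: dv.
have -> : d = u by apply: (Dun dD uD (v := x)); rewrite nb_sym.
by rewrite nb_sym.
Qed.

Lemma ndom_good v d : ~~ dom W v -> d \in D -> nb v d -> good W d.
Proof. by move=> nv dD vd; apply: D_good => //; apply: ndom_notinW vd. Qed.

(* A second outside neighbour [y] of [u] would be left undominable by [u2]:
   its candidates are [y] and, by [P4_freeQ], neighbours of [u2]. *)
Lemma good_pair u u2 y : good W u -> good W u2 -> G u u2 ->
  outside Q y -> G u y -> y = u2.
Proof.
move=> gu gu2 uu2 oy uy; apply/eqP/negPn/negP=> ne.
have ny : ~~ dom W y by apply: cand_ndom (good_cand gu) (adj_nb uy).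
have n2y : ~~ nb u2 y.
  rewrite /nb eq_sym (negbTE ne) /=; apply/negP=> /colP.
  by move: (colP uu2) (colP uy); do 3 case: (col _).
have [_ /(_ y ny n2y)[u' [yu' cu' /farP fu']]] := goodP _ _ gu2.
move: yu'; rewrite /nb => /orP[/eqP E | yu'].
  subst u'; move: (fu' u); rewrite nb_sym (nb_sym u2) adj_nb // => /(_ isT).
  by rewrite adj_nb.
have := @P4_freeQ u' y u u2 (cand_outside cu') oy (cand_outside (good_cand gu))
  (cand_outside (good_cand gu2)).
rewrite adj_sym yu' adj_sym uy uu2 => /(_ isT isT isT) u'u2.
by have := fu' u2 (adj_nb u'u2); rewrite nbxx.
Qed.

Lemma good_pair_uniq u u2 u3 : good W u -> good W u2 -> G u u2 ->
  good W u3 -> G u u3 -> u3 = u2.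
Proof.
by move=> gu gu2 uu2 gu3; apply: good_pair => //; apply/cand_outside/good_cand.
Qed.

(** The witness [v] is undominated by [W], so its dominator in [D] is good; being the only good
    choice, [u] is that dominator. *)
Lemma forced_D u : forced W u -> u \in D.
Proof.
case/forcedP=> gu [v uv h]; have [d dD vd] := Dex v.
rewrite -(h d) //; apply: ndom_good vd => //; exact: cand_ndom (good_cand gu) uv.
Qed.

Lemma good_solo u : good W u -> (forall u', G u u' -> ~~ good W u') -> forced W u.
Proof.
move=> gu h; apply/forcedP; split=> //; exists u; rewrite ?nbxx // => u'.
by rewrite /nb => /orP[/eqP // | /h/negbTE->].
Qed.

(** The witness of forcing is [a]: its only good neighbour is its dominator [d] in [D]. Another good
    neighbour [z] would be contested, so by [contestedW] it would share a neighbour with a seed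
    vertex and could not be a candidate. *)
Lemma good_attached u u2 a : good W u -> good W u2 -> G u u2 ->
  G u a -> a != u2 -> forced W u.
Proof.
move=> gu gu2 uu2 ua ne; apply/forcedP; split=> //; exists a; first exact: adj_nb.
have na : ~~ dom W a by apply: cand_ndom (good_cand gu) (adj_nb ua).
have nga : ~~ good W a.
  by apply: contraNN ne => ga; rewrite (good_pair_uniq gu gu2 uu2 ga ua).
have [d dD ad] := Dex a; have gd := ndom_good na dD ad.
have {}ad : G a d.
  by move: ad; rewrite /nb => /orP[/eqP E|//]; move: nga; rewrite E gd.
have key z : G a z -> good W z -> z = d.
  move=> az gz; apply/eqP/negPn/negP=> nzd.
  have zD : z \notin D.
    by apply: contraNN nzd => zD; rewrite (Dun zD dD (adj_nb az) (adj_nb ad)).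
  (* A good vertex without good neighbours is forced, hence in [D]. *)
  have /existsP[z2 /andP[zz2 gz2]] : [exists z2, G z z2 && good W z2].
    apply: contraNT zD => /existsPn h; apply/forced_D/good_solo => // u' zu'.
    by move: (h u'); rewrite zu'.
  (* The dominator of [z] in [D] is good and adjacent to [z], so it is the unique partner [z2]. *)
  have z2D : z2 \in D.
    have [e eD ze] := Dex z; have nz := cand_ndom (good_cand gz) (nbxx z).
    have ge := ndom_good nz eD ze; move: ze zD; rewrite /nb.
    case/orP=> [/eqP-> | ze]; first by rewrite eD.
    by rewrite -(good_pair_uniq gz gz2 zz2 ge ze).
  have lz : contested D Q z.
    split=> //; first exact/cand_outside/good_cand.
      exists z2; split=> // y oy z2y; apply: good_pair z2y => //.
      by rewrite adj_sym.
    by exists d, a; split=> //; rewrite adj_sym.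
  have [w [b [wW wb bz]]] := contestedW lz.
  have zb : nb z b by rewrite nb_sym adj_nb.
  by move/candP/(_ b w wW zb): (good_cand gz); rewrite nb_sym adj_nb.
have E : u = d by apply: key; rewrite // adj_sym.
move=> u'; rewrite E /nb => /orP[/eqP <- | ]; first by rewrite (negbTE nga).
exact: key.
Qed.

(** The chosen set departs from [D] only inside an unforced pair, where the order picked the other
    end. *)
Lemma final_free u : final lt W u -> u \notin D ->
  exists u2, [/\ good W u, good W u2, G u u2, ~~ forced W u & ~~ final lt W u2].
Proof.
move=> fu uD; have uW : u \notin W by apply: contraNN uD; apply: WD.
have npu : ~~ forced W u by apply: contraNN uD; apply: forced_D.
move: fu; rewrite /final (negbTE uW) (negbTE npu) /= => /andP[gu /existsPn h].
have /existsP[u2 /andP[uu2 gu2]] : [exists u2, G u u2 && good W u2].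
  apply: contraNT npu => /existsPn h'; apply: good_solo => // u' uu'.
  by move: (h' u'); rewrite uu'.
exists u2; split=> //; rewrite /final gu2 /=.
have := h u2; rewrite uu2 gu2 /= negb_or negbK => /andP[/negbTE-> ltu].
rewrite negb_or /= negbK; apply/andP; split.
  apply/negP=> u2W; move/candP/(_ u2 u2 u2W): (good_cand gu).
  by rewrite adj_nb // nbxx => /(_ isT).
apply/existsP; exists u; rewrite adj_sym uu2 gu (negbTE npu) /=.
rewrite -ltP //; apply/eqP=> E; by move: uu2; rewrite E adj_irrefl.
Qed.

Lemma D_free d : d \in D -> ~~ final lt W d ->
  exists u2, [/\ good W d, good W u2, G d u2, ~~ forced W d & final lt W u2].
Proof.
move=> dD; rewrite /final negb_or => /andP[dW].
have gd := D_good dD dW; rewrite gd /= negb_or negbK => /andP[npd].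
case/existsP=> u2 /and3P[du2 gu2]; case/orP=> [/forced_D u2D | ltd].
  by move: du2; rewrite Dadj.
exists u2; split=> //; rewrite gu2 /=; apply/orP; right; apply/orP; right.
apply/existsPn=> u'; apply/negP=> /and3P[u2u' gu'].
have E : u' = d by apply: good_pair_uniq u2u' => //; rewrite adj_sym.
rewrite E (negbTE npd) /= ltP ?negbK ?(negbTE ltd) //.
by apply/eqP=> E'; move: du2; rewrite E' adj_irrefl.
Qed.

(** By [good_attached], any neighbour other than [u2] would force [u]; so an unforced [u] has degree
    one in the whole graph. *)
Lemma free_nb u u2 v : good W u -> good W u2 -> G u u2 -> ~~ forced W u ->
  nb v u -> v = u \/ v = u2.
Proof.
move=> gu gu2 uu2 npu; rewrite /nb => /orP[/eqP|]; first by left.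
rewrite adj_sym => uv; right; apply/eqP; apply: contraNT npu => ne.
exact: good_attached uv ne.
Qed.

Lemma final_free_uniq u u2 v d : good W u -> good W u2 -> G u u2 ->
  ~~ forced W u -> ~~ final lt W u2 -> final lt W d -> nb v u -> nb v d -> d = u.
Proof.
move=> gu gu2 uu2 npu nf fd vu vd.
(* If [d] were in the seed, [v] would already be dominated and [u] would not be a candidate. *)
have gd : good W d.
  move: (fd); rewrite /final => /orP[dW | /andP[] //].
  have uv : nb u v by rewrite nb_sym.
  by move/candP/(_ v d dW uv): (good_cand gu); rewrite vd.
have nd2 : d <> u2 by move=> E; rewrite -E fd in nf.
case: (free_nb gu gu2 uu2 npu vu) => E; subst v; move: vd; rewrite /nb.
  case/orP=> [/eqP // | ud]; case: nd2; exact: good_pair_uniq ud.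
case/orP=> [/eqP E | u2d]; first by case: nd2.
by apply: good_pair_uniq u2d => //; rewrite adj_sym.
Qed.

(** The chosen set arises from [D] by exchanging the ends of some unforced pairs, and by [free_nb]
    such an exchange is invisible outside the pair. *)
Lemma final_efficient_dominating :
  efficient_dominating G [set u | final lt W u].
Proof.
apply/efficient_dominatingP; split=> [v | v d d'].
  have [d dD vd] := Dex v.
  have [fd | /(D_free dD)[u2 [gd gu2 du2 npd fu2]]] := boolP (final lt W d).
    by exists d; rewrite ?inE.
  exists u2; rewrite ?inE //; case: (free_nb gd gu2 du2 npd vd) => ->.
    exact: adj_nb.
  exact: nbxx.
rewrite !inE => fd fd' vd vd'.
have [dD | /(final_free fd)[u2 [? ? ? ? ?]]] := boolP (d \in D); last first.
  by apply/esym; apply: (final_free_uniq (u2 := u2) (v := v)).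
have [d'D | /(final_free fd')[u2 [? ? ? ? ?]]] := boolP (d' \in D); last first.
  by apply: (final_free_uniq (u2 := u2) (v := v)).
exact: (Dun dD d'D vd vd').
Qed.

End Propagation.

End Graph.

(** * Seeds of bounded size *)

Section P4Copies.
Variables (T : finType) (G : sgraph T) (col : T -> bool).
Hypothesis colP : forall x y, G x y -> col x != col y.

Lemma col_adjF x y : col x = col y -> G x y = false.
Proof. by move=> E; apply/negP=> /colP; rewrite E eqxx. Qed.

Lemma path4_twinfree (a b : 'I_4) :
  (forall c : 'I_4, path_rel a c = path_rel b c) -> a = b.
Proof.
move=> h; apply: val_inj; move: (h (@Ordinal 4 0 isT)) (h (@Ordinal 4 1 isT))
  (h (@Ordinal 4 2 isT)) (h (@Ordinal 4 3 isT)).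
by case: a b {h} => [[|[|[|[|a]]]] ha] // [[|[|[|[|b]]]] hb].
Qed.

Lemma path4_nbr (a : 'I_4) : exists b : 'I_4, path_rel a b.
Proof.
by case: a => [[|[|[|[|a]]]] ha] //; [exists (@Ordinal 4 1 isT) |
  exists (@Ordinal 4 0 isT) | exists (@Ordinal 4 1 isT) | exists (@Ordinal 4 2 isT)].
Qed.

(* Injectivity is automatic because disjoint unions of [P4] have no twins. *)
Lemma P4_copies_intro k (f : 'I_k * 'I_4 -> T) :
  (forall x y, G (f x) (f y) = copies k (path_graph 4) x y) ->
  induced_copy (copies k (path_graph 4)) G.
Proof.
move=> h; exists f; split=> // [[i a] [j b]] E.
have tw z : copies_rel (path_graph 4) (i, a) z = copies_rel (path_graph 4) (j, b) z.
  by move: (h (i, a) z) (h (j, b) z); rewrite /= E => <-.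
have Eij : i = j.
  have [c ac] := path4_nbr a; have := tw (i, c).
  by rewrite /copies_rel /= eqxx ac => /esym/andP[/eqP].
subst j; congr (_, _); apply: path4_twinfree => c.
by have := tw (i, c); rewrite /copies_rel /= eqxx.
Qed.

(** Greedy: as long as some [P4] avoids the closed neighbourhood of the copies found so far, it is
    added as one more independent copy; otherwise the vertices of these copies form [Q]. *)
Lemma P4_cover k : (exists Q : {set T}, #|Q| <= 4 * k /\
    forall x1 x2 x3 x4, outside G Q x1 -> outside G Q x2 ->
     outside G Q x3 -> outside G Q x4 -> G x1 x2 -> G x2 x3 -> G x3 x4 -> G x1 x4)
  \/ induced_copy (copies k (path_graph 4)) G.
Proof.
elim: k => [|k [[Q [hQ PQ]] | [f [_ hf]]]].
- right; exists (fun x : 'I_0 * 'I_4 => match x.1 with Ordinal _ h => False_rect T (notF h) end).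
  by split=> [[[]]|[[]]].
- by left; exists Q; split=> //; lia.
pose Q := f @: setT.
pose out u := [forall q in Q, ~~ nb G q u].
have outP u : reflect (outside G Q u) (out u) by apply: forall_inP.
have [/existsP[x1 /existsP[x2 /existsP[x3 /existsP[x4]]]] | no] := boolP
  [exists x1, exists x2, exists x3, exists x4,
    [&& out x1, out x2, out x3, out x4, G x1 x2, G x2 x3, G x3 x4 & ~~ G x1 x4]];
  last first.
  left; exists Q; split.
    apply: leq_trans (leq_imset_card _ _) _.
    by rewrite cardsT card_prod !card_ord mulnC; lia.
  move=> x1 x2 x3 x4 /outP o1 /outP o2 /outP o3 /outP o4 e1 e2 e3.
  apply: contraNT no => e4; apply/existsP; exists x1; apply/existsP; exists x2.
  apply/existsP; exists x3; apply/existsP; exists x4.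
  by rewrite o1 o2 o3 o4 e1 e2 e3.
case/and5P=> /outP o1 /outP o2 /outP o3 /outP o4 /and4P[e1 e2 e3 e4]; right.
pose p (a : 'I_4) := nth x1 [:: x1; x2; x3; x4] a.
have pout a : outside G Q (p a).
  by case: a => [[|[|[|[|a]]]] ha].
have pP a b : G (p a) (p b) = path_rel a b.
  (* In a bipartite graph only the edge [x1 x4] could spoil the path; vertices at distance two along
     it have equal colours. *)
  have e13 : G x1 x3 = false.
    by apply: col_adjF; move: (colP e1) (colP e2); do 3 case: (col _).
  have e24 : G x2 x4 = false.
    by apply: col_adjF; move: (colP e2) (colP e3); do 3 case: (col _).
  case: a b => [[|[|[|[|a]]]] ha] [[|[|[|[|b]]]] hb] //;
    rewrite /p /= /path_rel /= ?adj_irrefl ?e1 ?e2 ?e3 ?e13 ?e24 ?(negbTE e4) //;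
    by rewrite adj_sym ?e1 ?e2 ?e3 ?e13 ?e24 ?(negbTE e4).
have fp z a : G (f z) (p a) = false.
  apply/negP=> h; have := pout a (f z); rewrite adj_nb // => /(_ _)/negP.
  by apply=> //; apply: imset_f.
(* The new path takes the last index [ord_max]; the old copies keep theirs. *)
apply: (@P4_copies_intro _ (fun x : 'I_k.+1 * 'I_4 =>
  if unlift ord_max x.1 is Some j then f (j, x.2) else p x.2)).
move=> [i a] [j b] /=; rewrite /copies_rel /=.
case: unliftP => [i' ->|->]; case: unliftP => [j' ->|->].
- by rewrite hf /= /copies_rel /= (inj_eq lift_inj).
- by rewrite fp eq_sym (negbTE (neq_lift _ _)).
- by rewrite adj_sym fp (negbTE (neq_lift _ _)).
- by rewrite eqxx pP.
Qed.

(* In a minimal [S] every [d] has a private contested vertex [z]; the paths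
   [z2 - z - a - d] are then pairwise independent copies of [P4]. *)
Lemma uncontesting_set l (D Q : {set T}) (b : bool) :
  ~ induced_copy (copies l (path_graph 4)) G -> efficient_dominating G D ->
  exists S : {set T}, [/\ S \subset D, #|S| <= l &
    forall z, col z = b -> contested G D Q z ->
      exists d a, [/\ d \in S, G d a & G a z]].
Proof.
move=> free /efficient_dominatingP[Dex Dun].
pose out u := [forall q in Q, ~~ nb G q u].
have outP u : reflect (outside G Q u) (out u) by apply: forall_inP.
pose part z z2 := [&& z2 \in D, G z z2 & [forall y, out y ==> G z2 y ==> (y == z)]].
pose shares (S : {set T}) z := [exists d in S, [exists a, G d a && G a z]].
pose Z := [set z | [&& col z == b, z \notin D, out z, [exists z2, part z z2] & shares D z]].
have sharesP (S : {set T}) z : reflect (exists d a, [/\ d \in S, G d a & G a z]) (shares S z).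
  apply: (iffP existsP) => [[d /andP[dS /existsP[a /andP[da az]]]] | [d [a [dS da az]]]].
    by exists d, a.
  by exists d; rewrite dS; apply/existsP; exists a; rewrite da.
pose ok (S : {set T}) := (S \subset D) && [forall z in Z, shares S z].
have okD : ok D.
  rewrite /ok subxx; apply/forall_inP=> z; by rewrite inE => /and5P[].
case: (arg_minnP (fun S : {set T} => #|S|) okD) => S /andP[sSD /forall_inP cov] mini.
exists S; split=> //; last first.
  move=> z cz [zD /outP oz [z2 [z2D zz2 h]] /sharesP sz].
  apply/sharesP/cov; rewrite inE cz eqxx zD oz sz andbT /=.
  apply/existsP; exists z2; rewrite /part z2D zz2 /=; apply/forallP=> y.
  by apply/implyP=> /outP oy; apply/implyP=> z2y; apply/eqP; apply: h.
rewrite leqNgt; apply/negP=> hS; apply: free.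
(* By minimality, dropping [d] uncovers some [z] in [Z]; then [d] is the only member of [S] that
   shares a neighbour with [z]. *)
have priv d : d \in S -> exists z, [&& z \in Z, shares [set d] z & ~~ shares (S :\ d) z].
  move=> dS; have : ~~ ok (S :\ d).
    by apply/negP=> /mini; rewrite (cardsD1 d) dS; lia.
  rewrite /ok (subset_trans (subsetDl _ _) sSD) /= => /forall_inPn[z zZ ns].
  exists z; rewrite zZ ns andbT /=; have /sharesP[e [a [eS ea az]]] := cov z zZ.
  have [<- | ne] := eqVneq e d; first by apply/sharesP; exists e, a; rewrite set11.
  by case/sharesP: ns; exists e, a; rewrite !inE ne.
have lS : l <= #|S| by lia.
pose d i : T := enum_val (widen_ord lS i).
have dS i : d i \in S by apply: enum_valP.
have dD i : d i \in D by apply: (subsetP sSD).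
have d_inj : injective d by move=> i j /enum_val_inj/(congr1 val)/= /val_inj.
have /fin_all_exists[q hq] (i : 'I_l) : exists q : T * T * T,
    [/\ q.1.1 \in Z, part q.1.1 q.1.2, G (d i) q.2 && G q.2 q.1.1 & ~~ shares (S :\ d i) q.1.1].
  have [z /and3P[zZ /sharesP[e [a]]]] := priv _ (dS i).
  rewrite in_set1 => -[/eqP-> da az ns].
  move: (zZ); rewrite inE => /and5P[_ _ _ /existsP[z2 pz] _].
  by exists (z, z2, a); rewrite /= da az.
pose z i := (q i).1.1; pose z2 i := (q i).1.2; pose a i := (q i).2.
have zcol i : col (z i) = b by have [] := hq i; rewrite inE => /and5P[/eqP].
have znD i : z i \notin D by have [] := hq i; rewrite inE => /and5P[].
have zout i : out (z i) by have [] := hq i; rewrite inE => /and5P[].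
have z2D i : z2 i \in D by have [_ /and3P[]] := hq i.
have zz2 i : G (z i) (z2 i) by have [_ /and3P[]] := hq i.
have z2z i j : G (z2 i) (z j) -> z j = z i.
  have [_ /and3P[_ _ /forallP/(_ (z j))]] := hq i.
  by rewrite zout /= => /implyP h _ _ /h/eqP.
have da i : G (d i) (a i) by have [_ _ /andP[]] := hq i.
have az i : G (a i) (z i) by have [_ _ /andP[]] := hq i.
(* A cross edge would make [d i] share the neighbour [a i] with [z j], which is private to [d j]. *)
have az_inj i j : G (a i) (z j) -> i = j.
  move=> h; apply/eqP/negPn/negP=> ne; have [_ _ _ /sharesP[]] := hq j.
  by exists (d i), (a i); rewrite !inE dS da (inj_eq d_inj) ne.
have ad_inj i j : G (a i) (d j) -> i = j.
  move=> h; apply: d_inj; apply: (Dun (a i)); rewrite ?dD ?adj_nb //.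
  by rewrite adj_sym.
have DadjF x y : x \in D -> y \in D -> G x y = false.
  move=> xD yD; apply/negP=> xy; move: (xy).
  by rewrite (Dun x x y) ?nbxx ?adj_irrefl ?adj_nb.
have z_inj i j : z i = z j -> i = j.
  by move=> E; apply: az_inj; rewrite -E az.
have Ezz2 i j : G (z i) (z2 j) = (i == j).
  apply/idP/eqP=> [|-> //]; rewrite adj_sym => /z2z; exact: z_inj.
have Eza i j : G (z i) (a j) = (i == j).
  by apply/idP/eqP=> [|->]; rewrite adj_sym // => /az_inj.
have Ead i j : G (a i) (d j) = (i == j).
  by apply/idP/eqP=> [/ad_inj // | ->]; rewrite adj_sym.
(* Fixing the colour of the [z i] puts them and the [d i] on one side, the [a i] and [z2 i] on the
   other, which excludes all edges within either group. *)
have acol i : col (a i) = ~~ b by move: (colP (az i)); rewrite zcol; case: (col _); case: (b).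
have z2col i : col (z2 i) = ~~ b by move: (colP (zz2 i)); rewrite zcol; case: (col _); case: (b).
have dcol i : col (d i) = b by move: (colP (da i)); rewrite acol; case: (col _); case: (b).
apply: (@P4_copies_intro _ (fun x : 'I_l * 'I_4 =>
  nth (z2 x.1) [:: z2 x.1; z x.1; a x.1; d x.1] x.2)).
move=> [i [[|[|[|[|x]]]] hx]] // [j [[|[|[|[|y]]]] hy]] //;
  rewrite /= /copies_rel /= /path_rel /= ?andbF ?andbT ?Ezz2 ?Eza ?Ead //.
all: try by rewrite col_adjF ?zcol ?acol ?z2col ?dcol.
(* The pairs of [z2] and [d] have opposite colours, but both vertices lie in the independent set
   [D]. *)
all: try by rewrite DadjF.
all: by rewrite adj_sym ?Ezz2 ?Eza ?Ead // eq_sym.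
Qed.

(** Being contested depends on [D] and [Q] but not on the seed, so enlarging [W] inside [D] does no
    harm. This freedom allows padding the seed to a prescribed length. *)
Lemma bounded_seed l (D : {set T}) (lt : rel T) :
  (forall x y, x != y -> lt x y = ~~ lt y x) ->
  induced_free (copies l (path_graph 4)) G -> efficient_dominating G D ->
  exists W : {set T}, [/\ W \subset D, #|W| <= 6 * l &
    forall W' : {set T}, W \subset W' -> W' \subset D ->
      efficient_dominating G [set u | final G lt W' u]].
Proof.
move=> ltP free hD; have [Dex _] := proj1 (efficient_dominatingP G D) hD.
have [[Q [hQ PQ]] | //] := P4_cover l.
have [S0 [S0D cS0 hS0]] := uncontesting_set Q true free hD.
have [S1 [S1D cS1 hS1]] := uncontesting_set Q false free hD.
have /fin_all_exists[g hg] (q : T) : exists d, (d \in D) && nb G q d.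
  by have [d dD qd] := Dex q; exists d; rewrite dD.
exists (g @: Q :|: (S0 :|: S1)); split.
(* At most [4 * l] dominators of [Q], and at most [l] vertices for each colour class. *)
- rewrite !subUset S0D S1D !andbT; apply/subsetP=> _ /imsetP[q _ ->].
  by case/andP: (hg q).
- have := leq_imset_card g Q; have := (leq_card_setU S0 S1, leq_card_setU (g @: Q) (S0 :|: S1)).
  by move=> [[]] /= ? _ [] /= ? _ ?; lia.
move=> W sW WD; apply: (final_efficient_dominating (Q := Q) colP hD) => //.
  move=> q qQ; apply/existsP; exists (g q); have /andP[_ ->] := hg q.
  by rewrite (subsetP sW) // !inE imset_f.
move=> z lz; case E: (col z).
  by have [d [a [dS da az]]] := hS0 z E lz; exists d, a; rewrite (subsetP sW) // !inE dS !orbT.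
by have [d [a [dS da az]]] := hS1 z E lz; exists d, a; rewrite (subsetP sW) // !inE dS !orbT.
Qed.
End P4Copies.

(** * Evaluating first-order sentences on the machine *)

(* First-order formulas over (adjacency, =, <) with de Bruijn levels: when [k]
   variables are in scope, [FEx] binds the variable number [k]. *)
Inductive formula :=
  | FAdj (i j : nat) | FEq (i j : nat) | FLt (i j : nat)
  | FNot (f : formula) | FAnd (f g : formula) | FEx (f : formula).

Definition uenv (T : Type) (e : nat -> T) k (v : T) : nat -> T :=
  fun x => if x == k then v else e x.

Fixpoint sat n (G : sgraph 'I_n) k (e : nat -> 'I_n) f : bool :=
  match f with
  | FAdj i j => G (e i) (e j)
  | FEq i j => e i == e j
  | FLt i j => e i < e j
  | FNot g => ~~ sat G k e g
  | FAnd g h => sat G k e g && sat G k e h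
  | FEx g => [exists v, sat G k.+1 (uenv e k v) g]
  end.

Fixpoint wf k f : bool :=
  match f with
  | FAdj i j | FEq i j | FLt i j => (i < k) && (j < k)
  | FNot g => wf k g
  | FAnd g h => wf k g && wf k h
  | FEx g => wf k.+1 g
  end.

(* For lack of a multiplication instruction, each variable [i] keeps, next to its
   value, the offset of its row in the adjacency matrix in register [rreg i]. *)
Definition vreg i := i.*2 + 4.
Definition rreg i := i.*2 + 5.

(** Jumps are absolute, so the code depends on its start address [o]. Registers 0 and 1 hold [n] and
    1, and the truth value is left in register 2. A quantifier is a loop over the values of variable
    [k], left at the first success or when [n] minus the value is zero. *)
Fixpoint compile k o f : program :=
  match f with
  | FAdj i j => [:: Add 3 (rreg i) (vreg j); Read 2 3]
  | FEq i j => [:: Defs.Sub 2 (vreg i) (vreg j); Defs.Sub 3 (vreg j) (vreg i);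
                   Add 2 2 3; Defs.Sub 2 1 2]
  | FLt i j => [:: Defs.Sub 2 (vreg j) (vreg i); Defs.Sub 2 1 2; Defs.Sub 2 1 2]
  | FNot g => rcons (compile k o g) (Defs.Sub 2 1 2)
  | FAnd g h =>
      let c := compile k o g in
      let c' := compile k (o + size c).+1 h in
      c ++ Jzero 2 ((o + size c).+1 + size c') :: c'
  | FEx g =>
      let c := compile k.+1 (o + 4) g in
      let m := o + 4 + size c in
      [:: Const (vreg k) 0; Const (rreg k) 0; Defs.Sub 2 0 (vreg k); Jzero 2 (m + 5)]
      ++ c ++ [:: Jzero 2 (m + 2); Jump (m + 5);
          Add (vreg k) (vreg k) 1; Add (rreg k) (rreg k) 0; Jump (o + 2)]
  end.

(** An upper bound, since loops may stop early. A full round spends six instructions around its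
    body; initialisation and the last test take four. *)
Fixpoint cost f n : nat :=
  match f with
  | FAdj _ _ => 2
  | FEq _ _ => 4
  | FLt _ _ => 3
  | FNot g => cost g n + 1
  | FAnd g h => cost g n + (cost h n + 1)
  | FEx g => n * (cost g n + 7) + 4
  end.

Fixpoint cost_poly f : {poly nat} :=
  match f with
  | FAdj _ _ => 2%N%:P
  | FEq _ _ => 4%N%:P
  | FLt _ _ => 3%N%:P
  | FNot g => cost_poly g + 1%N%:P
  | FAnd g h => cost_poly g + (cost_poly h + 1%N%:P)
  | FEx g => 'X * (cost_poly g + 7%N%:P) + 4%N%:P
  end%R.

Lemma horner_cost f n : (cost_poly f).[n]%R = cost f n.
Proof.
by elim: f => /= [*|*|*|g <-|g <- h <-|g <-]; rewrite ?(hornerD, hornerM, hornerX, hornerC).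
Qed.

(** * Correctness and running time of the compiled code *)

Section Machine.
Variable P : program.

Definition code_at o c := forall i, i < size c -> onth P (o + i) = onth c i.

Lemma code_at_cat o c c' : code_at o (c ++ c') ->
  code_at o c /\ code_at (o + size c) c'.
Proof.
move=> h; split=> i hi.
  by rewrite h ?onth_cat ?hi // size_cat; lia.
rewrite -addnA h ?size_cat ?onth_cat; last by lia.
by rewrite ifF ?addKn //; lia.
Qed.

Lemma code_at_cons o i c : code_at o (i :: c) ->
  onth P o = Some i /\ code_at o.+1 c.
Proof.
move=> h; split; first by rewrite -(addn0 o) h.
by move=> j hj; rewrite addSnnS h.
Qed.

Definition reach t s s' := exists2 m, m <= t & iter m (step P) s = s'.

Lemma reach0 s : reach 0 s s. Proof. by exists 0. Qed.

Lemma reach_trans t t' s s' s'' :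
  reach t s s' -> reach t' s' s'' -> reach (t + t') s s''.
Proof.
by case=> m hm <- [m' hm' <-]; exists (m' + m); [lia | rewrite iterD].
Qed.

Lemma reach_le t t' s s' : t <= t' -> reach t s s' -> reach t' s s'.
Proof. by move=> h [m hm E]; exists m => //; lia. Qed.

Lemma reach_step t p i R M s' : onth P p = Some i ->
  reach t (exec i (Config p R M)) s' -> reach t.+1 (Config p R M) s'.
Proof.
move=> hi [m hm E]; exists m.+1 => //.
by rewrite iterSr /step hi.
Qed.

Variables (n : nat) (G : sgraph 'I_n) (M : nat -> nat).
Hypothesis M_adj : forall i j : 'I_n, M (i * n + j) = G i j.

Definition represents k (e : nat -> 'I_n) (R : nat -> nat) :=
  [/\ R 0 = n, R 1 = 1 &
   forall i, i < k -> R (vreg i) = e i /\ R (rreg i) = e i * n].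

(* Registers 2 and 3 are scratch, and [vreg k] is the first register above
   those of the variables in scope. *)
Definition agree k (R R' : nat -> nat) :=
  forall r, r < vreg k -> r != 2 -> r != 3 -> R' r = R r.

Lemma agree_trans k R R' R'' : agree k R R' -> agree k R' R'' -> agree k R R''.
Proof. by move=> h h' r *; rewrite h' ?h. Qed.

Lemma agree_represents k e R R' :
  agree k R R' -> represents k e R -> represents k e R'.
Proof.
move=> h [R0 R1 Rv]; rewrite /agree /vreg in h; split; rewrite ?h //; try lia.
move=> i hi; have [<- <-] := Rv i hi; rewrite /vreg /rreg.
by split; apply: h; lia.
Qed.

Lemma updE f k v x : upd f k v x = if x == k then v else f x.
Proof. by []. Qed.

Lemma compile_correct f k o e R : wf k f -> code_at o (compile k o f) ->
  represents k e R ->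
  exists R', [/\ reach (cost f n) (Config o R M)
                   (Config (o + size (compile k o f)) R' M),
                 R' 2 = sat G k e f & agree k R R'].
Proof.
elim: f k o e R => [i j|i j|i j|g IH|g IHg h IHh|g IH] k o e R /=.
- move=> /andP[hi hj] /code_at_cons[c1 /code_at_cons[c2 _]] [R0 R1 Rv].
  have [Ri Ri'] := Rv i hi; have [Rj Rj'] := Rv j hj.
  eexists; split.
  + apply: (reach_step c1); apply: (reach_step c2).
    rewrite /= addn2; exact: reach0.
  + by rewrite /= !updE /= Ri' Rj M_adj.
  + by move=> r _ h2 h3; rewrite !updE (negbTE h2) (negbTE h3).
- move=> /andP[hi hj] /code_at_cons[c1 /code_at_cons[c2 /code_at_cons[c3 /code_at_cons[c4 _]]]] [R0 R1 Rv].
  have [Ri Ri'] := Rv i hi; have [Rj Rj'] := Rv j hj.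
  eexists; split.
  + apply: (reach_step c1); apply: (reach_step c2).
    apply: (reach_step c3); apply: (reach_step c4).
    rewrite /= addn4; exact: reach0.
  + have V x : (vreg x == 2) = false by rewrite /vreg; lia.
    rewrite /upd /= !V Ri Rj R1 -val_eqE /=; lia.
  + by move=> r _ h2 h3; rewrite !updE (negbTE h2) (negbTE h3).
- move=> /andP[hi hj] /code_at_cons[c1 /code_at_cons[c2 /code_at_cons[c3 _]]] [R0 R1 Rv].
  have [Ri Ri'] := Rv i hi; have [Rj Rj'] := Rv j hj.
  eexists; split.
  + apply: (reach_step c1); apply: (reach_step c2).
    apply: (reach_step c3).
    rewrite /= addn3; exact: reach0.
  + rewrite /= !updE /= Ri Rj R1; case: ltngtP; lia.
  + by move=> r _ h2 h3; rewrite !updE (negbTE h2).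
- rewrite -cats1 => wg /code_at_cat[cg /code_at_cons[c1 _]] Rep.
  have [R' [rg R2 ag]] := IH k o e R wg cg Rep.
  have [_ R1 _] := agree_represents ag Rep.
  eexists; split.
  + apply: (reach_trans rg).
    apply: (reach_step c1); rewrite /= size_cat addn1 addnS; exact: reach0.
  + by rewrite /= updE /= R1 R2; case: sat.
  + by move=> r hr h2 h3; rewrite updE (negbTE h2) ag.
- move=> /andP[wg wh] /code_at_cat[cg /code_at_cons[c1 ch]] Rep.
  have [R' [rg R2 ag]] := IHg k o e R wg cg Rep.
  have Rep' := agree_represents ag Rep.
  have [R'' [rh R2' ah]] := IHh k _ e R' wh ch Rep'.
  set c := compile k o g in cg c1 ch rg rh *; set c' := compile k _ h in ch rh *.
  have -> : o + size (c ++ Jzero 2 ((o + size c).+1 + size c') :: c') =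
      (o + size c).+1 + size c' by rewrite size_cat /=; lia.
  case E : (sat G k e g) R2 => R2; last first.
    exists R'; split=> //; apply: (reach_trans rg).
    apply: (@reach_le 1); first by lia.
    apply: (reach_step c1); rewrite /= R2 /=; exact: reach0.
  exists R''; split=> //; last exact: agree_trans ag ah.
  apply: (reach_trans rg); rewrite addn1.
  by apply: (reach_step c1); rewrite /= R2.
- set c := compile _ _ g => wg /code_at_cons[c1 /code_at_cons[c2]].
  case/code_at_cons=> c3 /code_at_cons[c4 /code_at_cat[]].
  rewrite -addn4 => cg /code_at_cons[c5 /code_at_cons[c6]].
  case/code_at_cons=> c7 /code_at_cons[c8 /code_at_cons[c9 _]] Rep.
  set fin := o + _.
  have Efin : fin = o + 4 + size c + 5 by rewrite /fin size_cat /=; lia.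
  rewrite -Efin in c4 c6; clearbody fin.
  (* Loop invariant, by induction on the number [m] of values still to be tried: [x] is the current
     value and all smaller ones have failed. *)
  have loop m x R1 : x + m = n -> agree k R R1 -> R1 (vreg k) = x ->
      R1 (rreg k) = x * n ->
      (forall v : 'I_n, v < x -> ~~ sat G k.+1 (uenv e k v) g) ->
      exists R', [/\ reach (m * (cost g n + 7) + 2) (Config o.+2 R1 M)
        (Config fin R' M), R' 2 = [exists v, sat G k.+1 (uenv e k v) g]
        & agree k R R'].
    elim: m x R1 => [|m IHm] x R1 xm agR Rv Rr no.
      have [R0 _ _] := agree_represents agR Rep.
      eexists; split.
      + apply: (reach_step c3); apply: (reach_step c4).
        rewrite /= updE /= R0 Rv -xm addn0 subnn /=; exact: reach0.
      + rewrite updE eqxx; apply/esym/eqP.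
        rewrite eqb0; apply/existsPn=> v; apply: no; have := ltn_ord v; lia.
      + by move=> r hr h2 h3; rewrite updE (negbTE h2) agR.
    have hx : x < n by lia.
    pose v := Ordinal hx.
    have [R0 R1' Rlt] := agree_represents agR Rep.
    pose R2 := upd R1 2 (n - x).
    have ag2 : agree k R R2.
      by move=> r hr h2 h3; rewrite /R2 updE (negbTE h2) agR.
    have Rep2 : represents k.+1 (uenv e k v) R2.
      have [R20 R21 R2v] := agree_represents ag2 Rep; split=> // i.
      rewrite ltnS leq_eqVlt => /predU1P[-> | hi]; rewrite /uenv.
        rewrite eqxx /R2 !updE /vreg /rreg !ifF; try lia.
        by rewrite -/(vreg k) -/(rreg k) Rv Rr.
      by rewrite ifF; [exact: R2v | lia].
    have [R3 [rg R32 ag3]] := IH k.+1 _ _ R2 wg cg Rep2.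
    have ag3' : agree k R R3.
      move=> r hr h2 h3; rewrite ag3 ?ag2 //; move: hr; rewrite /vreg; lia.
    (* The loop test and the body, common to a successful and a failing round. *)
    have pre t s : reach t (Config (o + 4 + size c) R3 M) s ->
        reach (cost g n + t).+2 (Config o.+2 R1 M) s.
      move=> h; apply: (reach_step c3); apply: (reach_step c4).
      rewrite /= updE /= R0 Rv ifF; last by lia.
      by apply: reach_trans h; rewrite -addn4.
    case E : (sat G k.+1 (uenv e k v) g) R32 => R32.
      exists R3; split=> //.
        apply: (@reach_le (cost g n + 2).+2); first by rewrite mulSn; lia.
        apply: pre; apply: (reach_step c5); rewrite /= R32 /=.
        apply: (reach_step c6); exact: reach0.
      by rewrite R32; apply/esym/eqP; rewrite eqb1; apply/existsP; exists v.
    pose R4 := upd R3 (vreg k) x.+1; pose R5 := upd R4 (rreg k) (x.+1 * n).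
    have [|||||R' [rl R'2 ag']] := IHm x.+1 R5.
    + by lia.
    + move=> r hr h2 h3; rewrite /R5 /R4 !updE !ifF ?ag3' //.
        by move: hr; rewrite /vreg; lia.
      by move: hr; rewrite /vreg /rreg; lia.
    + by rewrite /R5 /R4 !updE ifF ?eqxx // /vreg /rreg; lia.
    + by rewrite /R5 updE eqxx.
    + move=> w; rewrite ltnS leq_eqVlt => /predU1P[wx | /no //].
      by have -> : w = v by [apply: val_inj]; rewrite E.
    exists R'; split=> //.
    apply: (@reach_le (cost g n + (4 + (m * (cost g n + 7) + 2))).+2).
      by rewrite mulSn; lia.
    apply: pre; apply: (reach_step c5); rewrite /= R32 /= (addn2 (o + 4 + size c)).
    apply: (reach_step c7); apply: (reach_step c8); apply: (reach_step c9).
    rewrite (addn2 o) /=.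
    have [R30 R31 _] := agree_represents ag3' Rep.
    have R3v : R3 (vreg k) = x.
      by rewrite ag3 /R2 ?updE /vreg ?ifF ?Rv //; lia.
    have R3r : R3 (rreg k) = x * n.
      by rewrite ag3 /R2 ?updE /vreg /rreg ?ifF //; lia.
    have vk : (rreg k == vreg k) = false by rewrite /vreg /rreg; lia.
    have v0 : (0 == vreg k) = false by rewrite /vreg; lia.
    by rewrite !updE R30 R31 R3v vk v0 R3r addn1 -mulSnr.
  pose R1 := upd R (vreg k) 0; pose R2 := upd R1 (rreg k) 0.
  have [|||||R' [rl R'2 ag']] := loop n 0 R2; rewrite ?add0n //.
  + move=> r hr h2 h3; rewrite /R2 /R1 !updE !ifF //.
      by move: hr; rewrite /vreg; lia.
    by move: hr; rewrite /vreg /rreg; lia.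
  + by rewrite /R2 /R1 !updE ifF ?eqxx // /vreg /rreg; lia.
  + by rewrite /R2 updE eqxx.
  exists R'; split=> //.
  rewrite (_ : _ + 4 = (n * (cost g n + 7) + 2).+2); last by lia.
  by apply: (reach_step c1); apply: (reach_step c2).
Qed.
End Machine.

Lemma nth_allpairs_ord n (G : sgraph 'I_n) (i j : 'I_n) :
  nth 0 [seq nat_of_bool (G i j) | i <- enum 'I_n, j <- enum 'I_n] (i * n + j) = G i j.
Proof.
(* The induction removes rows, so the list of rows is generalised while the columns stay fixed. *)
have aux (s : seq 'I_n) a : a < size s ->
   nth 0 [seq nat_of_bool (G i j) | i <- s, j <- enum 'I_n] (a * n + j) = G (nth i s a) j.
  elim: s a => [|x s IH] [|a] //= ha; rewrite nth_cat size_map size_enum_ord.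
    by rewrite mul0n add0n ltn_ord (nth_map j) ?size_enum_ord ?nth_ord_enum.
  rewrite ifF; last by rewrite mulSn -addnA; lia.
  by rewrite mulSn -addnA addKn IH.
by rewrite aux ?size_enum_ord // nth_ord_enum.
Qed.

(** On the empty graph no environment exists, so that case jumps to the last instruction and answers
    yes. Otherwise register 2 is copied to register 0 by adding a zero. *)
Definition decider f : program :=
  let c := compile 0 2 f in
  [:: Const 1 1; Jzero 0 (5 + size c)] ++ c ++
  [:: Const 3 0; Add 0 2 3; Jump (6 + size c); Const 0 1].

Lemma poly_time_formula (C Q : forall n, sgraph 'I_n -> Prop) f :
  wf 0 f ->
  (forall G : sgraph 'I_0, C 0 G -> Q 0 G) ->
  (forall n (G : sgraph 'I_n) e, C n G -> sat G 0 e f <-> Q n G) ->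
  poly_time_on C Q.
Proof.
move=> wff Q0 Qsat; exists (decider f), (cost_poly f + 5%N%:P)%R => n G CG.
rewrite hornerD hornerC horner_cost.
have sz : size (decider f) = 6 + size (compile 0 2 f).
  by rewrite /= size_cat /=; lia.
suff [s' [[t ht E] hs' Rs']] : exists s', [/\ reach (decider f) (cost f n + 5) (init G) s',
    pc s' = size (decider f) & reg s' 0 != 0 <-> Q n G].
  by exists t; rewrite /= E; split; rewrite // /halted hs'.
have := @code_at_cons (decider f) 0 (Const 1 1) _ (fun i _ => erefl _).
case=> c1 /code_at_cons[c2 /code_at_cat[cf]].
case/code_at_cons=> c3 /code_at_cons[c4 /code_at_cons[c5 /code_at_cons[c6 _]]].
rewrite sz /init; set M := nth 0 _; set R := upd _ 0 n; set R1 := upd R 1 1.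
case: n G CG @M @R @R1 => [|n] G CG M R R1.
  eexists; split.
  + rewrite addnC; apply: (@reach_le _ 3); first by lia.
    apply: (reach_step c1); apply: (reach_step c2) => /=.
    apply: (reach_step c6); exact: reach0.
  + by [].
  + by split=> // _; apply: Q0.
(* With no variable in scope, any environment is represented. *)
have Rep : represents 0 (fun _ => ord0 : 'I_n.+1) R1 by split.
have [R' [rf R2 _]] := compile_correct (nth_allpairs_ord G) wff cf Rep.
eexists; split.
+ rewrite addnC; apply: (reach_step c1); apply: (reach_step c2) => /=.
  apply: (@reach_le _ (cost f n.+1 + 3)); first by lia.
  apply: (reach_trans rf).
  apply: (reach_step c3); apply: (reach_step c4); apply: (reach_step c5).
  exact: reach0.
+ by [].
+ by rewrite /= /upd /= R2 addn0 eqb0 negbK; apply: Qsat.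
Qed.

(** * The sentence *)

Definition f_or f g := FNot (FAnd (FNot f) (FNot g)).
Definition f_nb i j := f_or (FEq i j) (FAdj i j).
(** The empty disjunction is falsity, spelled as [FNot (FEq 0 0)]; it is well formed once some
    variable is in scope. *)
Definition f_big (F : nat -> formula) c :=
  foldr (fun i => f_or (F i)) (FNot (FEq 0 0)) (iota 0 c).
(** The seed consists of the values of the first [c] variables, bound by the outermost quantifiers
    of [f_sentence]. *)
Definition f_seed c x := f_big (fun i => FEq i x) c.
Definition f_dom c x := f_big (f_nb x) c.
Definition f_cand c k x := FNot (FEx (FAnd (f_nb x k) (f_dom c k))).
Definition f_far k x y := FNot (FEx (FAnd (f_nb x k) (f_nb y k))).
Definition f_good c k x := FAnd (f_cand c k x)
  (FNot (FEx (FAnd (FNot (f_dom c k)) (FAnd (FNot (f_nb x k))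
     (FNot (FEx (FAnd (f_nb k k.+1)
        (FAnd (f_cand c k.+2 k.+1) (f_far k.+2 k.+1 x))))))))).
Definition f_forced c k x := FAnd (f_good c k x)
  (FEx (FAnd (f_nb x k) (FNot (FEx (FAnd (f_nb k k.+1)
     (FAnd (f_good c k.+2 k.+1) (FNot (FEq k.+1 x)))))))).
Definition f_final c k x := f_or (f_seed c x) (FAnd (f_good c k x)
  (f_or (f_forced c k x) (FNot (FEx (FAnd (FAdj x k) (FAnd (f_good c k.+1 k)
     (f_or (f_forced c k.+1 k) (FNot (FLt x k))))))))).
Definition f_eds c k := FNot (FEx (FNot (FEx (FAnd
  (FAnd (f_nb k k.+1) (f_final c k.+2 k.+1))
  (FNot (FEx (FAnd (f_nb k k.+2) (FAnd (f_final c k.+3 k.+2)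
     (FNot (FEq k.+2 k.+1)))))))))).
Definition f_sentence c := iter c FEx (f_eds c c).

(** * Semantics of the sentence *)

Section Sat.
Variables (n : nat) (G : sgraph 'I_n) (c : nat).
Implicit Types (e : nat -> 'I_n).

Definition seed e := [set w in map e (iota 0 c)].

Lemma seed_uenv e k v : c <= k -> seed (uenv e k v) = seed e.
Proof.
move=> ck; rewrite /seed; suff /eq_in_map-> : {in iota 0 c, uenv e k v =1 e} by [].
by move=> i; rewrite mem_iota add0n /uenv => hi; rewrite ifF //; lia.
Qed.

Lemma uenv_eq (e : nat -> 'I_n) k v : uenv e k v k = v.
Proof. by rewrite /uenv eqxx. Qed.

Lemma uenv_lt (e : nat -> 'I_n) k v x : x < k -> uenv e k v x = e x.
Proof. by move=> h; rewrite /uenv ifF //; lia. Qed.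

Lemma sat_not k e f : sat G k e (FNot f) = ~~ sat G k e f.
Proof. by []. Qed.

Lemma sat_and k e f g : sat G k e (FAnd f g) = sat G k e f && sat G k e g.
Proof. by []. Qed.

Lemma sat_ex k e f :
  sat G k e (FEx f) = [exists v, sat G k.+1 (uenv e k v) f].
Proof. by []. Qed.

Lemma sat_eq k e i j : sat G k e (FEq i j) = (e i == e j).
Proof. by []. Qed.

Lemma sat_or k e f g : sat G k e (f_or f g) = sat G k e f || sat G k e g.
Proof. by rewrite /f_or !(sat_not, sat_and) negb_and !negbK. Qed.

Lemma sat_nb k e i j : sat G k e (f_nb i j) = nb G (e i) (e j).
Proof. exact: sat_or. Qed.

Lemma sat_big k e F :
  sat G k e (f_big F c) = has (fun i => sat G k e (F i)) (iota 0 c).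
Proof.
rewrite /f_big; elim: (iota 0 c) => [|i s IH]; first by rewrite /= eqxx.
by rewrite [RHS]/= -IH -sat_or.
Qed.

Lemma sat_seed k e x : sat G k e (f_seed c x) = (e x \in seed e).
Proof.
rewrite sat_big inE -has_pred1 has_map; apply: eq_has => i /=; by rewrite eq_sym.
Qed.

Lemma sat_dom k e x : sat G k e (f_dom c x) = dom G (seed e) (e x).
Proof.
rewrite sat_big; apply/hasP/existsP=> [[i hi] | [w /andP[]]].
  rewrite sat_nb => h; exists (e i); rewrite h andbT inE; exact: map_f.
by rewrite inE => /mapP[i hi ->] h; exists i; rewrite ?sat_nb.
Qed.

Lemma sat_far k e x y : x < k -> y < k ->
  sat G k e (f_far k x y) = far G (e x) (e y).
Proof.
move=> hx hy; rewrite /f_far sat_not sat_ex; congr (~~ _).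
by apply: eq_existsb => v; rewrite sat_and !sat_nb uenv_eq !uenv_lt.
Qed.

Lemma sat_cand k e x : c <= k -> x < k ->
  sat G k e (f_cand c k x) = cand G (seed e) (e x).
Proof.
move=> ck hx; rewrite /f_cand sat_not sat_ex; congr (~~ _).
apply: eq_existsb => v.
by rewrite sat_and sat_nb sat_dom seed_uenv // uenv_eq uenv_lt.
Qed.

Lemma sat_good k e x : c <= k -> x < k ->
  sat G k e (f_good c k x) = good G (seed e) (e x).
Proof.
move=> ck hx; rewrite /f_good sat_and sat_cand // sat_not sat_ex.
congr (_ && ~~ _); apply: eq_existsb => v.
rewrite sat_and sat_not sat_dom sat_and sat_not sat_nb sat_not sat_ex.
rewrite seed_uenv // uenv_eq uenv_lt //.
congr [&& ~~ _, ~~ _ & ~~ _]; apply: eq_existsb => u.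
rewrite !sat_and sat_nb sat_cand ?sat_far ?seed_uenv //; try lia.
by rewrite !(uenv_eq, uenv_lt) //; lia.
Qed.

Lemma sat_forced k e x : c <= k -> x < k ->
  sat G k e (f_forced c k x) = forced G (seed e) (e x).
Proof.
move=> ck hx; rewrite /f_forced sat_and sat_good // sat_ex.
congr (_ && _); apply: eq_existsb => v.
rewrite sat_and sat_nb uenv_eq uenv_lt // sat_not sat_ex.
congr (_ && ~~ _); apply: eq_existsb => u.
rewrite sat_and sat_nb sat_and sat_good ?sat_not ?seed_uenv //; try lia.
by rewrite sat_eq !(uenv_eq, uenv_lt) //; lia.
Qed.

Definition lt_ord : rel 'I_n := fun x y => x < y.

Lemma sat_final k e x : c <= k -> x < k ->
  sat G k e (f_final c k x) = final G lt_ord (seed e) (e x).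
Proof.
move=> ck hx; rewrite /f_final sat_or sat_seed sat_and sat_good //.
rewrite sat_or sat_forced // sat_not sat_ex.
congr (_ || (_ && (_ || ~~ _))); apply: eq_existsb => u.
rewrite sat_and sat_and sat_good ?sat_or ?sat_forced ?seed_uenv //; try lia.
by rewrite sat_not /= uenv_eq uenv_lt.
Qed.

Lemma sat_eds e :
  sat G c e (f_eds c c) <-> efficient_dominating G [set u | final G lt_ord (seed e) u].
Proof.
have -> : sat G c e (f_eds c c) = ~~ [exists v, ~~ [exists d,
    (nb G v d && final G lt_ord (seed e) d) && ~~ [exists d',
      [&& nb G v d', final G lt_ord (seed e) d' & d' != d]]]].
  rewrite /f_eds sat_not sat_ex; congr (~~ _); apply: eq_existsb => v.
  rewrite sat_not sat_ex; congr (~~ _); apply: eq_existsb => d.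
  rewrite !sat_and sat_nb sat_final ?seed_uenv //; try lia.
  rewrite uenv_eq uenv_lt // uenv_eq sat_not sat_ex.
  congr (_ && ~~ _); apply: eq_existsb => d'.
  rewrite !sat_and sat_not sat_nb sat_final ?seed_uenv //; try lia.
  by rewrite sat_eq !(uenv_eq, uenv_lt) //; lia.
rewrite efficient_dominatingP; split=> [/existsPn h | [ex un]].
  have {}h v : exists d, [/\ nb G v d, final G lt_ord (seed e) d &
      forall d', nb G v d' -> final G lt_ord (seed e) d' -> d' = d].
    have := h v; rewrite negbK => /existsP[d /andP[/andP[vd fd] /existsPn un]].
    exists d; split=> // d' vd' fd'; apply/eqP; have := un d'.
    by rewrite vd' fd' /= negbK.
  split=> [v | v d d']; first by have [d [vd fd _]] := h v; exists d; rewrite ?inE.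
  rewrite !inE => fd fd' vd vd'; have [d0 [_ _ un]] := h v.
  exact: etrans (un _ vd fd) (esym (un _ vd' fd')).
apply/existsPn=> v; rewrite negbK; have [d] := ex v; rewrite inE => fd vd.
apply/existsP; exists d; rewrite vd fd; apply/existsPn=> d'.
apply/negP=> /and3P[vd' fd' /eqP[]]; by apply: (un v); rewrite ?inE.
Qed.

Fixpoint extend e k (s : seq 'I_n) :=
  if s is v :: s' then extend (uenv e k v) k.+1 s' else e.

Lemma extend_lt e k s i : i < k -> extend e k s i = e i.
Proof.
by elim: s e k => //= v s IH e k hi; rewrite IH ?uenv_lt //; lia.
Qed.

Lemma map_extend e k s : map (extend e k s) (iota k (size s)) = s.
Proof.
by elim: s e k => //= v s IH e k; rewrite IH extend_lt ?uenv_eq.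
Qed.

Lemma sat_iter_ex m k e f : sat G k e (iter m FEx f) <->
  exists2 s, size s = m & sat G (k + m) (extend e k s) f.
Proof.
elim: m k e => [|m IH] k e.
  by rewrite addn0; split=> [h | [[|v s] //=]]; first by exists [::].
rewrite iterS sat_ex addnS -addSn; split=> [/existsP[v /IH[s ss h]] | [[|v s] //= [ss] h]].
  by exists (v :: s); rewrite /= ?ss.
by apply/existsP; exists v; apply/IH; exists s.
Qed.

End Sat.

(** * Well-formedness of the sentence *)

Lemma wf_not k f : wf k (FNot f) = wf k f. Proof. by []. Qed.
Lemma wf_and k f g : wf k (FAnd f g) = wf k f && wf k g. Proof. by []. Qed.
Lemma wf_ex k f : wf k (FEx f) = wf k.+1 f. Proof. by []. Qed.
Lemma wf_or k f g : wf k (f_or f g) = wf k f && wf k g. Proof. by []. Qed.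

Lemma wf_nb k i j : wf k (f_nb i j) = (i < k) && (j < k).
Proof. by rewrite wf_or /= andbb. Qed.

Section WellFormed.
Variables (c k x : nat).
Hypotheses (ck : c <= k) (xk : x < k).

Lemma wf_big F : (forall i, i < c -> wf k (F i)) -> wf k (f_big F c).
Proof.
move=> h; rewrite /f_big; have : all (fun i => i < c) (iota 0 c).
  by apply/allP=> i; rewrite mem_iota.
elim: (iota 0 c) => [|i s IH] /=; first by rewrite (leq_ltn_trans _ xk).
by case/andP=> /h hi /IH hs; apply/andP.
Qed.

Lemma wf_seed : wf k (f_seed c x).
Proof. by apply: wf_big => i hi /=; lia. Qed.

Lemma wf_dom : wf k (f_dom c x).
Proof. by apply: wf_big => i hi; rewrite wf_nb; lia. Qed.

End WellFormed.

Lemma wf_cand c k x : c <= k -> x < k -> wf k (f_cand c k x).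
Proof. by move=> ck xk; rewrite wf_not wf_ex wf_and wf_nb wf_dom; lia. Qed.

Lemma wf_good c k x : c <= k -> x < k -> wf k (f_good c k x).
Proof.
move=> ck xk; rewrite wf_and wf_cand // wf_not wf_ex wf_and wf_not wf_dom; try lia.
rewrite wf_and wf_not wf_nb wf_not wf_ex wf_and wf_nb wf_and wf_cand; try lia.
by rewrite wf_not wf_ex wf_and !wf_nb; lia.
Qed.

Lemma wf_forced c k x : c <= k -> x < k -> wf k (f_forced c k x).
Proof.
move=> ck xk; rewrite wf_and wf_good // wf_ex wf_and wf_nb wf_not wf_ex.
by rewrite wf_and wf_nb wf_and wf_good /=; lia.
Qed.

Lemma wf_final c k x : c <= k -> x < k -> wf k (f_final c k x).
Proof.
move=> ck xk; rewrite wf_or wf_seed // wf_and wf_good // wf_or wf_forced //.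
rewrite wf_not wf_ex wf_and wf_and wf_good; try lia.
by rewrite wf_or wf_forced /=; lia.
Qed.

Lemma wf_iter_ex m k f : wf k (iter m FEx f) = wf (k + m) f.
Proof. by elim: m k => [|m IH] k; rewrite ?addn0 // iterS wf_ex IH addSnnS. Qed.

Lemma wf_sentence c : wf 0 (f_sentence c).
Proof.
rewrite wf_iter_ex add0n wf_not wf_ex wf_not wf_ex wf_and wf_and wf_nb.
rewrite wf_final; try lia; rewrite wf_not wf_ex wf_and wf_nb wf_and.
by rewrite wf_final /=; lia.
Qed.

Theorem theorem6 (l : nat) (hl : 2 <= l) :
  poly_time_on
    (fun (n : nat) (G : sgraph 'I_n) =>
       bipartite G /\ induced_free (copies l (path_graph 4)) G)
    (fun (n : nat) (G : sgraph 'I_n) => has_eds G).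
Proof.
apply: (poly_time_formula (wf_sentence (6 * l))) => [G _ | n G e [[col colP] free]].
  by exists set0; case.
have seed_extend s : size s = 6 * l ->
    seed (6 * l) (extend e 0 s) = [set x in s].
  by move=> <-; rewrite /seed map_extend.
(* A satisfying seed exhibits its own efficient dominating set. *)
split=> [/sat_iter_ex[s _ /sat_eds h] | [D hD]]; first by eexists; apply: h.
have [Dex _] := proj1 (efficient_dominatingP G D) hD.
have [d0 d0D _] := Dex (e 0).
have lt_ordP (x y : 'I_n) : x != y -> lt_ord x y = ~~ lt_ord y x.
  by rewrite -val_eqE /lt_ord -leqNgt ltn_neqAle => ->.
have [W [WD cW hW]] := bounded_seed colP lt_ordP free hD.
(* The sentence quantifies over exactly [6 * l] seed variables. Padding with [d0], an element of
   [D], works even if [W] is empty, and [bounded_seed] tolerates the extra vertex. *)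
pose s := enum W ++ nseq (6 * l - #|W|) d0.
have ss : size s = 6 * l by rewrite size_cat size_nseq -cardE; lia.
apply/sat_iter_ex; exists s => //; apply/sat_eds; rewrite seed_extend //.
apply: hW; apply/subsetP=> x; rewrite inE mem_cat mem_enum; first by move=> ->.
by case/orP=> [/(subsetP WD) // | /nseqP[->]].
Qed.
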